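(* Let $M$ be a metric space. (a) $M$ is complete (every Cauchy sequence in $M$ converges) if and only if, in $\mathrm{sFilt}$, the lifting property $$(\emptyset\to\mathbb N^{\bullet}_{cof})\ \pitchfork\ (M_{u}[+1]\xrightarrow{[-1]}M_{u})$$ holds. In particular, $$(\emptyset\to\mathbb N^{\bullet}_{cof})\in\{M_{u}[+1]\xrightarrow{[-1]}M_{u}\,:\,M\text{ is a complete metric space}\}^{l},$$ and hence $(\emptyset\to\mathbb N^{\bullet}_{cof})\in\{\mathbb R_{u}[+1]\xrightarrow{[-1]}\mathbb R_{u}\}^{l}$, where $\mathbb R$ carries its usual metric. (b) If the morphism $M_{u}[+1]\xrightarrow{[-1]}M_{u}$ belongs to $\left(\{\mathbb R_{u}[+1]\xrightarrow{[-1]}\mathbb R_{u}\}^{l}\right)^{r}$, then $M$ is complete. (c) The converse of (b) holds for precompact metric spaces: if $M$ is precompact and complete, then $M_{u}[+1]\xrightarrow{[-1]}M_{u}$ belongs to $\left(\{\mathbb R_{u}[+1]\xrightarrow{[-1]}\mathbb R_{u}\}^{l}\right)^{r}$.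
   Context: A filter on a set $X$ is a collection of subsets of $X$, called neighbourhoods, closed under finite intersections (in particular containing $X$) and under passing to supersets; $\emptyset$ is allowed to be a neighbourhood and $X$ is allowed to be empty. A morphism of filters (a continuous map) is a function of the underlying sets such that the preimage of every neighbourhood is a neighbourhood. $\mathrm{Filt}$ is the category of filters. $\Delta$ is the category of finite linear orders $n_\le=\{0<\dots<n-1\}$, $n\ge 1$, and non-decreasing maps, and $\mathrm{sFilt}=\mathrm{Fun}(\Delta^{op},\mathrm{Filt})$ is the category of simplicial filters; a morphism in $\mathrm{sFilt}$ is a map of the underlying simplicial sets which is continuous at every level. $\emptyset$ denotes the initial object (levelwise empty). Lifting: for morphisms $i:A\to B$ and $p:X\to Y$ of a category, $i\pitchfork p$ means that for all $f:A\to X$, $g:B\to Y$ with $p f=g i$ there is $h:B\to X$ with $h i=f$ and $p h=g$. For a class $P$ of morphisms, $P^{l}=\{i: i\pitchfork p\text{ for all }p\in P\}$ and $P^{r}=\{p: i\pitchfork p\text{ for all }i\in P\}$. Shift: $[+1]:\Delta\to\Delta$ adds a new minimal element (preserved by morphisms), and $X[+1]:=X\circ[+1]$, so $X[+1](n_\le)=X((n+1)_\le)$ as filters. The inclusions $n_\le\to (n+1)_\le$ omitting the new minimal element give a natural morphism $[-1]:X[+1]\to X$. For a metric space $M$, $M_{u}\in\mathrm{sFilt}$ has underlying simplicial set $n_\le\mapsto \mathrm{Hom}_{\mathrm{Sets}}(n,M)=M^n$, and $\varepsilon\subset M^n$ is a neighbourhood iff there is $\epsilon>0$ such that $(x_1,\dots,x_n)\in\varepsilon$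 whenever $\mathrm{dist}(x_i,x_j)<\epsilon$ for all $i,j$. Thus $[-1]:M_{u}[+1]\to M_{u}$ is the projection $M\times M^n\to M^n$ forgetting the first coordinate. $\mathbb N^{\bullet}_{cof}\in\mathrm{sFilt}$ has underlying simplicial set $n_\le\mapsto\mathbb N^n$, where a subset of $\mathbb N^n$ is a neighbourhood iff it contains $\{(i_1,\dots,i_n): i_1,\dots,i_n>N\}$ for some $N$. A metric space is precompact iff every ultrafilter on it is Cauchy (equivalently, it is totally bounded). *)

(* Defs.v *)
From HB Require Import structures.
From mathcomp Require Import all_boot all_order all_algebra.
From mathcomp Require Import all_classical all_reals topology normedtype.

Set Implicit Arguments.
Unset Strict Implicit.
Unset Printing Implicit Defensive.

Import Order.TTheory GRing.Theory Num.Theory.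
Import numFieldNormedType.Exports.

Local Open Scope classical_set_scope.
Local Open Scope ring_scope.

Record category := Category {
  obj :> Type ;
  mor : obj -> obj -> Type ;
  idmor : forall A, mor A A ;
  mcomp : forall A B C, mor B C -> mor A B -> mor A C ;
  mcomp1m : forall A B (f : mor A B), mcomp (idmor B) f = f ;
  mcompm1 : forall A B (f : mor A B), mcomp f (idmor A) = f ;
  mcompA : forall A B C D (h : mor C D) (g : mor B C) (f : mor A B),
    mcomp h (mcomp g f) = mcomp (mcomp h g) f }.

Arguments mor {c} A B.
Arguments idmor {c} A.
Arguments mcomp {c A B C} g f.

Definition opposite (C : category) : category :=
  @Category C (fun A B => @mor C B A) (@idmor C)
    (fun A B D g f => mcomp f g)
    (fun A B f => mcompm1 f) (fun A B f => mcomp1m f)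
    (fun A B D E h g f => esym (mcompA f g h)).

Record functor (C D : category) := Functor {
  fobj :> C -> D ;
  fmor : forall A B : C, mor A B -> mor (fobj A) (fobj B) ;
  fmor1 : forall A, fmor (idmor A) = idmor (fobj A) ;
  fmorM : forall A B E (g : mor B E) (f : mor A B),
    fmor (mcomp g f) = mcomp (fmor g) (fmor f) }.

Arguments fmor {C D} _ {A B} _.

Lemma functor_comp_1 (C D E : category) (G : functor D E) (F : functor C D)
    (A : C) : fmor G (fmor F (idmor A)) = idmor (G (F A)).
Proof. by rewrite !fmor1. Qed.

Lemma functor_comp_M (C D E : category) (G : functor D E) (F : functor C D)
    (X Y Z : C) (g : mor Y Z) (f : mor X Y) :
  fmor G (fmor F (mcomp g f)) = mcomp (fmor G (fmor F g)) (fmor G (fmor F f)).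
Proof. by rewrite !fmorM. Qed.

Definition functor_comp (C D E : category) (G : functor D E) (F : functor C D) :
    functor C E :=
  @Functor C E (fun A => G (F A)) (fun A B f => fmor G (fmor F f))
    (functor_comp_1 G F) (@functor_comp_M _ _ _ G F).

Definition opposite_functor (C D : category) (F : functor C D) :
    functor (opposite C) (opposite D) :=
  @Functor (opposite C) (opposite D) F (fun A B (f : @mor C B A) => fmor F f)
    (@fmor1 _ _ F) (fun A B E g f => fmorM F f g).

Record nat_trans (C D : category) (F G : functor C D) := NatTrans {
  component :> forall A, mor (F A) (G A) ;
  naturality : forall A B (f : mor A B),
    mcomp (component B) (fmor F f) = mcomp (fmor G f) (component A) }.

Lemma nat_trans_ext (C D : category) (F G : functor C D) (s t : nat_trans F G) :
  (forall A, s A = t A) -> s = t.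
Proof.
case: s t => [s sP] [t tP] /= st.
have {}st : s = t by apply: functional_extensionality_dep.
by case: t / st tP => tP; congr NatTrans; exact: Prop_irrelevance.
Qed.

Lemma nat_trans_id_natural (C D : category) (F : functor C D) (A B : C)
    (f : mor A B) :
  mcomp (idmor (F B)) (fmor F f) = mcomp (fmor F f) (idmor (F A)).
Proof. by rewrite mcomp1m mcompm1. Qed.

Definition nat_trans_id (C D : category) (F : functor C D) : nat_trans F F :=
  NatTrans (@nat_trans_id_natural C D F).

Lemma nat_trans_comp_natural (C D : category) (F G H : functor C D)
    (t : nat_trans G H) (s : nat_trans F G) (A B : C) (f : mor A B) :
  mcomp (mcomp (t B) (s B)) (fmor F f) = mcomp (fmor H f) (mcomp (t A) (s A)).
Proof. by rewrite -mcompA naturality mcompA naturality mcompA. Qed.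

Definition nat_trans_comp (C D : category) (F G H : functor C D)
    (t : nat_trans G H) (s : nat_trans F G) : nat_trans F H :=
  NatTrans (nat_trans_comp_natural t s).

Lemma nat_trans_comp1m (C D : category) (F G : functor C D)
  (s : nat_trans F G) : nat_trans_comp (nat_trans_id G) s = s.
Proof. by apply: nat_trans_ext => A; exact: mcomp1m. Qed.

Lemma nat_trans_compm1 (C D : category) (F G : functor C D)
  (s : nat_trans F G) : nat_trans_comp s (nat_trans_id F) = s.
Proof. by apply: nat_trans_ext => A; exact: mcompm1. Qed.

Lemma nat_trans_compA (C D : category) (F G H K : functor C D)
    (u : nat_trans H K) (t : nat_trans G H) (s : nat_trans F G) :
  nat_trans_comp u (nat_trans_comp t s) = nat_trans_comp (nat_trans_comp u t) s.
Proof. by apply: nat_trans_ext => A; exact: mcompA. Qed.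

Definition functor_category (C D : category) : category :=
  @Category (functor C D) (@nat_trans C D) (@nat_trans_id C D)
    (@nat_trans_comp C D) (@nat_trans_comp1m C D) (@nat_trans_compm1 C D)
    (@nat_trans_compA C D).

Record arrow (C : category) := Arrow {
  source : C ;
  target : C ;
  arrow_mor :> mor source target }.

Arguments Arrow {C source target} arrow_mor.

Definition lifts (C : category) (i p : arrow C) : Prop :=
  forall (f : mor (source i) (source p)) (g : mor (target i) (target p)),
    mcomp p f = mcomp g i ->
    exists h : mor (target i) (source p), mcomp h i = f /\ mcomp p h = g.

Definition left_orth (C : category) (P : arrow C -> Prop) : arrow C -> Prop :=
  fun i => forall p, P p -> lifts i p.

Definition right_orth (C : category) (P : arrow C -> Prop) : arrow C -> Prop :=
  fun p => forall i, P i -> lifts i p.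

(** [Filter] allows [set0] as a neighbourhood. *)
Record filt := Filt {
  carrier :> Type ;
  nbhd : set_system carrier ;
  nbhd_filter : Filter nbhd }.

Record filt_hom (X Y : filt) := FiltHom {
  filt_fun :> X -> Y ;
  filt_cont : forall V : set Y, nbhd V -> nbhd (filt_fun @^-1` V) }.

Lemma filt_hom_ext (X Y : filt) (f g : filt_hom X Y) : f =1 g -> f = g.
Proof.
case: f g => [f fP] [g gP] /= /funext fg.
by case: g / fg gP => gP; congr FiltHom; exact: Prop_irrelevance.
Qed.

Definition filt_id (X : filt) : filt_hom X X :=
  @FiltHom X X id (fun V VX => VX).

Definition filt_comp (X Y Z : filt) (g : filt_hom Y Z) (f : filt_hom X Y) :
    filt_hom X Z :=
  @FiltHom X Z (fun x => g (f x)) (fun V ZV => filt_cont f (filt_cont g ZV)).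

Lemma filt_comp1m (X Y : filt) (f : filt_hom X Y) : filt_comp (filt_id Y) f = f.
Proof. exact: filt_hom_ext. Qed.

Lemma filt_compm1 (X Y : filt) (f : filt_hom X Y) : filt_comp f (filt_id X) = f.
Proof. exact: filt_hom_ext. Qed.

Lemma filt_compA (X Y Z W : filt) (h : filt_hom Z W) (g : filt_hom Y Z)
    (f : filt_hom X Y) :
  filt_comp h (filt_comp g f) = filt_comp (filt_comp h g) f.
Proof. exact: filt_hom_ext. Qed.

Definition Filt_cat : category :=
  Category filt_comp1m filt_compm1 filt_compA.

(** The object [n : nat] stands for the linear order with [n.+1] elements,
    carried by ['I_n.+1]. *)
Record monotone_map (m n : nat) := Monotone {
  mono_fun :> 'I_m.+1 -> 'I_n.+1 ;
  mono_homo : {homo mono_fun : i j / (i <= j)%N} }.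

Lemma monotone_ext (m n : nat) (f g : monotone_map m n) : f =1 g -> f = g.
Proof.
case: f g => [f fP] [g gP] /= /funext fg.
by case: g / fg gP => gP; congr Monotone; exact: Prop_irrelevance.
Qed.

Definition mono_id (n : nat) : monotone_map n n :=
  @Monotone n n id (fun i j ij => ij).

Definition mono_comp (l m n : nat) (g : monotone_map m n)
    (f : monotone_map l m) :
    monotone_map l n :=
  @Monotone l n (fun i => g (f i)) (fun i j ij => mono_homo g (mono_homo f ij)).

Lemma mono_comp1m (m n : nat) (f : monotone_map m n) :
  mono_comp (mono_id n) f = f.
Proof. exact: monotone_ext. Qed.

Lemma mono_compm1 (m n : nat) (f : monotone_map m n) :
  mono_comp f (mono_id m) = f.
Proof. exact: monotone_ext. Qed.

Lemma mono_compA (k l m n : nat) (h : monotone_map m n) (g : monotone_map l m)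
    (f : monotone_map k l) :
  mono_comp h (mono_comp g f) = mono_comp (mono_comp h g) f.
Proof. exact: monotone_ext. Qed.

Definition Delta : category := Category mono_comp1m mono_compm1 mono_compA.

(** The endofunctor [+1] of Delta: the new minimal element is [ord0], and the
    old elements are embedded by [lift ord0]. *)
Definition succ_fun (m n : nat) (f : 'I_m.+1 -> 'I_n.+1) (i : 'I_m.+2) :
    'I_n.+2 :=
  if unlift ord0 i is Some j then lift ord0 (f j) else ord0.

Lemma succ_fun_homo (m n : nat) (f : monotone_map m n) :
  {homo succ_fun f : i j / (i <= j)%N}.
Proof.
move=> i j; rewrite /succ_fun.
case: unliftP => [i' ->|-> //]; case: unliftP => [j' ->|-> //].
by rewrite !lift0 !ltnS; exact: mono_homo.
Qed.

Definition succ_map (m n : nat) (f : monotone_map m n) :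
    monotone_map m.+1 n.+1 :=
  Monotone (@succ_fun_homo m n f).

Lemma succ_map_id (n : nat) : succ_map (mono_id n) = mono_id n.+1.
Proof.
by apply: monotone_ext => i /=; rewrite /succ_fun; case: unliftP => [j ->|->].
Qed.

Lemma succ_map_comp (l m n : nat) (g : monotone_map m n)
    (f : monotone_map l m) :
  succ_map (mono_comp g f) = mono_comp (succ_map g) (succ_map f).
Proof.
apply: monotone_ext => i /=; rewrite /succ_fun.
by case: unliftP => [j _|_]; rewrite ?liftK ?unlift_none.
Qed.

Definition Delta_succ : functor Delta Delta :=
  @Functor Delta Delta S succ_map succ_map_id succ_map_comp.

Lemma skip0_homo (n : nat) :
  {homo (fun i : 'I_n.+1 => lift ord0 i : 'I_n.+2) : i j / (i <= j)%N}.
Proof. by move=> i j ij; rewrite !lift0. Qed.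

Definition skip0 (n : nat) : monotone_map n n.+1 := Monotone (@skip0_homo n).

Lemma skip0_natural (m n : nat) (f : monotone_map m n) :
  mono_comp (succ_map f) (skip0 m) = mono_comp (skip0 n) f.
Proof. by apply: monotone_ext => i; rewrite /= /succ_fun liftK. Qed.

Definition sFilt : category := functor_category (opposite Delta) Filt_cat.

Definition sshift (X : sFilt) : sFilt :=
  functor_comp X (opposite_functor Delta_succ).

Definition shift_proj_component (X : sFilt) (n : nat) :
    filt_hom (sshift X n) (X n) :=
  @fmor _ _ X n.+1 n (skip0 n).

Lemma shift_proj_natural (X : sFilt) (m n : opposite Delta) (f : mor m n) :
  mcomp (shift_proj_component X n : @mor Filt_cat _ _) (fmor (sshift X) f) =
  mcomp (fmor X f) (shift_proj_component X m : @mor Filt_cat _ _).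
Proof.
have fmX := fmorM X; rewrite /= in fmX.
by rewrite /shift_proj_component /= -!fmX skip0_natural.
Qed.

Definition shift_proj (X : sFilt) : @mor sFilt (sshift X) X :=
  @NatTrans (opposite Delta) Filt_cat (sshift X) X
    (shift_proj_component X) (@shift_proj_natural X).

(** The levelwise empty simplicial filter.  On the empty type all subsets are
    equal, so [setT] is the only filter. *)
Definition filt_void : filt := @Filt void setT (filter_setT void).

Lemma const_functor_M (X : filt) :
  idmor (X : Filt_cat) = mcomp (idmor (X : Filt_cat)) (idmor (X : Filt_cat)).
Proof. by rewrite mcomp1m. Qed.

Definition sEmpty : sFilt :=
  @Functor (opposite Delta) Filt_cat (fun=> filt_void)
    (fun _ _ _ => filt_id filt_void) (fun=> erefl)
    (fun _ _ _ _ _ => const_functor_M filt_void).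

Lemma from_void_cont (X : filt) (V : set X) :
  nbhd V -> @nbhd filt_void ((fun v : void => of_void X v) @^-1` V).
Proof. by []. Qed.

Definition from_void (X : filt) : filt_hom filt_void X :=
  @FiltHom filt_void X (of_void X) (@from_void_cont X).

Lemma from_empty_natural (X : sFilt) (m n : opposite Delta) (f : mor m n) :
  mcomp (from_void (X n) : @mor Filt_cat _ _) (fmor sEmpty f) =
  mcomp (fmor X f) (from_void (X m) : @mor Filt_cat _ _).
Proof. by apply: filt_hom_ext => -[]. Qed.

Definition from_empty (X : sFilt) : @mor sFilt sEmpty X :=
  @NatTrans (opposite Delta) Filt_cat sEmpty X
    (fun n => from_void (X n)) (@from_empty_natural X).

Lemma from_empty_unique (X : sFilt) (f : @mor sFilt sEmpty X) :
  f = from_empty X.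
Proof. by apply: nat_trans_ext => n; apply: filt_hom_ext => -[]. Qed.

Definition tuple_filt (T : Type) (F : forall n, set_system ('I_n.+1 -> T))
    (FF : forall n, Filter (F n)) (n : nat) : filt :=
  @Filt ('I_n.+1 -> T) (F n) (FF n).

Definition reindex_continuous (T : Type)
    (F : forall n, set_system ('I_n.+1 -> T)) : Prop :=
  forall (m n : nat) (s : monotone_map m n) (V : set ('I_m.+1 -> T)),
    F m V -> F n ((fun x : 'I_n.+1 -> T => x \o s) @^-1` V).

Definition tuple_reindex (T : Type) (F : forall n, set_system ('I_n.+1 -> T))
    (FF : forall n, Filter (F n)) (Fs : reindex_continuous F)
    (m n : nat) (s : monotone_map m n) :
    filt_hom (tuple_filt FF n) (tuple_filt FF m) :=
  @FiltHom (tuple_filt FF n) (tuple_filt FF m) (fun x => x \o s) (Fs m n s).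

Lemma reindex_id (T : Type) (F : forall n, set_system ('I_n.+1 -> T))
    (FF : forall n, Filter (F n)) (Fs : reindex_continuous F) (n : nat) :
  tuple_reindex FF Fs (mono_id n) = filt_id (tuple_filt FF n).
Proof. exact: filt_hom_ext. Qed.

Lemma reindex_comp (T : Type) (F : forall n, set_system ('I_n.+1 -> T))
    (FF : forall n, Filter (F n)) (Fs : reindex_continuous F)
    (n m l : nat) (t : monotone_map l m) (s : monotone_map m n) :
  tuple_reindex FF Fs (mono_comp s t) =
  filt_comp (tuple_reindex FF Fs t) (tuple_reindex FF Fs s).
Proof. exact: filt_hom_ext. Qed.

Definition tuple_sFilt (T : Type) (F : forall n, set_system ('I_n.+1 -> T))
    (FF : forall n, Filter (F n)) (Fs : reindex_continuous F) : sFilt :=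
  @Functor (opposite Delta) Filt_cat (tuple_filt FF)
    (fun n m (s : monotone_map m n) => tuple_reindex FF Fs s)
    (reindex_id FF Fs) (@reindex_comp _ _ FF Fs).

Definition metric_nbhd (R : realType) (M : metricType R) (n : nat) :
    set_system ('I_n.+1 -> M) :=
  [set V | exists2 e : R, 0 < e &
    forall x : 'I_n.+1 -> M, (forall i j, mdist (x i) (x j) < e) -> V x].

Lemma metric_nbhd_filter (R : realType) (M : metricType R) (n : nat) :
  Filter (@metric_nbhd R M n).
Proof.
split.
- by exists 1.
- move=> P Q [e e0 eP] [d d0 dQ]; exists (Num.min e d).
    by rewrite lt_min e0 d0.
  move=> x xed; split; [apply: eP|apply: dQ] => i j.
    by have := xed i j; rewrite lt_min => /andP[].
  by have := xed i j; rewrite lt_min => /andP[].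
- by move=> P Q PQ [e e0 eP]; exists e => // x xe; apply: PQ; exact: eP.
Qed.

Lemma metric_nbhd_reindex (R : realType) (M : metricType R) :
  reindex_continuous (@metric_nbhd R M).
Proof.
by move=> m n s V [e e0 eV]; exists e => // x xe; apply: eV => i j; exact: xe.
Qed.

Definition metric_sFilt (R : realType) (M : metricType R) : sFilt :=
  tuple_sFilt (@metric_nbhd_filter R M) (@metric_nbhd_reindex R M).

Definition metric_shift_arrow (R : realType) (M : metricType R) : arrow sFilt :=
  Arrow (shift_proj (metric_sFilt M)).

Definition cof_nbhd (n : nat) : set_system ('I_n.+1 -> nat) :=
  [set V | exists N : nat,
    forall x : 'I_n.+1 -> nat, (forall i, (N < x i)%N) -> V x].

Lemma cof_nbhd_filter (n : nat) : Filter (@cof_nbhd n).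
Proof.
split.
- by exists 0%N.
- move=> P Q [N NP] [K KQ]; exists (maxn N K).
  move=> x xNK; split; [apply: NP|apply: KQ] => i.
    by have := xNK i; rewrite gtn_max => /andP[].
  by have := xNK i; rewrite gtn_max => /andP[].
- by move=> P Q PQ [N NP]; exists N => x xN; apply: PQ; exact: NP.
Qed.

Lemma cof_nbhd_reindex : reindex_continuous cof_nbhd.
Proof.
by move=> m n s V [N NV]; exists N => x xN; apply: NV => i; exact: xN.
Qed.

Definition Ncof_sFilt : sFilt := tuple_sFilt cof_nbhd_filter cof_nbhd_reindex.

Definition Ncof_arrow : arrow sFilt := Arrow (from_empty Ncof_sFilt).

Definition metric_complete (R : realType) (M : metricType R) : Prop :=
  forall u : nat -> M, cauchy (u @ \oo) -> exists l : M, u @ \oo --> l.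

(** The library's [precompact] means relatively compact in an ambient space. *)
Definition metric_precompact (R : realType) (M : metricType R) : Prop :=
  forall F : set_system M, UltraFilter F -> cauchy F.

Definition complete_shift_arrows (R : realType) : arrow sFilt -> Prop :=
  fun p => exists M : metricType R,
    metric_complete M /\ p = metric_shift_arrow M.

(** The library puts the metric [`|y - x|] on the copy [R^o] of [R]. *)
Definition real_shift_arrow (R : realType) : arrow sFilt -> Prop :=
  fun p => p = metric_shift_arrow (R^o : metricType R).

(* Main.v *)
Require Import Defs.
From HB Require Import structures.
From mathcomp Require Import all_boot all_order all_algebra.
From mathcomp Require Import all_classical all_reals topology normedtype.
From mathcomp Require Import lra.

Import Order.TTheory GRing.Theory Num.Theory.
Import numFieldNormedType.Exports.

(** A map from the complex of natural numbers to [M_u] is a Cauchy sequence, and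
    a lift of a map [g : B -> M_u] to the shift is an apex [c(b)], constant on
    the connected components of [B] and close to the entries of [g(b)]; over
    the connected complex of natural numbers this is a limit of the sequence.

    For the converse on a precompact complete [M], lift each composition of [g]
    with the short map [mdist z : M -> R].  The apexes [t(b)(z)] so obtained
    form a point of [M -> R] close to the Kuratowski embedding of [g(b)], and a
    retraction [psi] of that embedding yields the apex [psi (t b)].  No
    continuity of [t] or [psi] is needed away from [M], because an apex only
    has to be face-invariant and close to [g]; and [psi] being a retraction
    makes the lift agree with the one prescribed on the source. *)

Local Open Scope classical_set_scope.
Local Open Scope ring_scope.

(** * Sequences in terms of the distance *)

Lemma cauchy_seq_mdistP {R : realType} {M : metricType R} (u : nat -> M) :
  cauchy (u @ \oo) <->
  forall e : R, 0 < e -> exists N, forall m n, (N < m)%N -> (N < n)%N ->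
    mdist (u m) (u n) < e.
Proof.
split=> [/cauchyP uC e e0|uC].
  have e2 : 0 < e / 2 by rewrite divr_gt0.
  have [x [N _ xN]] := uC _ e2.
  exists N => m n /ltnW Nm /ltnW Nn.
  have := xN m Nm; have := xN n Nn; rewrite /= ballEmdist /= => xn xm.
  have := metric_triangle (u m) x (u n).
  by rewrite (metric_sym (u m) x) => /le_lt_trans; apply; lra.
apply/cauchyP => e e0; have [N uN] := uC e e0.
exists (u N.+1), N.+1 => // n /= Nn.
by rewrite ballEmdist /=; exact: uN.
Qed.

Lemma cvg_seq_mdistP {R : realType} {M : metricType R} (u : nat -> M) (l : M) :
  u @ \oo --> l <->
  forall e : R, 0 < e -> exists N, forall n, (N < n)%N -> mdist l (u n) < e.
Proof.
split=> [/metricType_numDomainType.cvgrPdist_lt ul e e0|ul].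
  by have [N _ uN] := ul e e0; exists N => n /ltnW Nn; exact: uN.
apply/metricType_numDomainType.cvgrPdist_lt => e e0; have [N uN] := ul e e0.
by exists N.+1 => // n /= Nn; exact: uN.
Qed.

Lemma real_metric_complete (R : realType) : metric_complete (R^o : metricType R).
Proof. by move=> u /cauchy_cvg uC; exists (lim (u @ \oo)). Qed.

(** * Finite nets and the Kuratowski embedding *)

Lemma ler_dist_mdist {R : realType} {M : metricType R} (z x y : M) :
  `|mdist z x - mdist z y| <= mdist x y.
Proof.
rewrite ler_norml.
have := metric_triangle z x y; have := metric_triangle z y x.
by rewrite (metric_sym y x) => ? ?; apply/andP; split; lra.
Qed.

(** Without a net, the sets [far s] generate a proper filter. An ultrafilter above it is Cauchy, so
    it contains an [e]-ball about some [x], which is disjoint from [far [:: x]]. *)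
Lemma precompact_finite_net {R : realType} {M : metricType R} :
  metric_precompact M -> forall e : R, 0 < e ->
  exists s : seq M, forall y, exists2 z, z \in s & mdist z y < e.
Proof.
move=> pM e e0; apply: contrapT => nonet.
pose far (s : seq M) : set M := [set y | forall z, z \in s -> e <= mdist z y].
have far_proper : ProperFilter (filter_from setT far).
  apply: filter_from_proper; last first.
    move=> s _; apply: contrapT => sfar; apply: nonet; exists s => y.
    apply: contrapT => ys; apply: sfar; exists y => z zs.
    by rewrite leNgt; apply/negP => zy; apply: ys; exists z.
  apply: filter_from_filter; first by exists [::].
  move=> s t _ _; exists (s ++ t) => // y sty.
  by split=> z zst; apply: sty; rewrite mem_cat zst ?orbT.
have [G [GU farG]] := ultraFilterLemma far_proper.
have [x Gx] := (@cauchyP _ _ G _).1 (pM G GU) e e0.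
have Gfar : G (far [:: x]) by apply: farG; exists [:: x].
have [y [xy]] := filter_ex (filterI Gx Gfar).
move=> /(_ x (mem_head _ _)).
by move: xy; rewrite ballEmdist /= => xy; rewrite leNgt xy.
Qed.

(* [psi] is a retraction of the Kuratowski embedding [a |-> mdist ^~ a] that is
   uniformly continuous at the points of [M], although it need not be
   continuous elsewhere. *)
Lemma kuratowski_retraction {R : realType} {M : metricType R} :
  metric_precompact M -> metric_complete M -> M ->
  exists psi : (M -> R) -> M, forall e : R, 0 < e ->
    exists (s : seq M) (d : R), 0 < d /\ forall t y,
      (forall z, z \in s -> `|t z - mdist z y| < d) -> mdist (psi t) y < e.
Proof.
move=> pM cM x0.
pose r j : R := j.+1%:R^-1.
have r0 j : 0 < r j by rewrite invr_gt0.
have [net netP] := choice (fun j => precompact_finite_net pM _ (r0 j)).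
(* The points whose distance function cannot be told from [t] on the nets up to [J]. These sets
   shrink as [J] grows. *)
pose good (t : M -> R) J y :=
  forall j, (j <= J)%N -> forall z, z \in net j -> `|t z - mdist z y| < r j.
have good_le t J J' y : (J <= J')%N -> good t J' y -> good t J y.
  by move=> JJ' yJ' j /leq_trans /(_ JJ'); exact: yJ'.
have good_diam t J y y' : good t J y -> good t J y' -> mdist y y' < 4 * r J.
  (* A net point [z] within [r J] of [y] is within [3 * r J] of [y'], whence the constant 4. *)
  move=> yJ y'J; have [z zJ zy] := netP J y.
  have := yJ J (leqnn J) z zJ; have := y'J J (leqnn J) z zJ.
  rewrite !ltr_norml => /andP[? ?] /andP[? ?].
  by have := metric_triangle y z y'; rewrite (metric_sym y z) => ?; lra.
have r_small e : 0 < e -> exists J, 4 * r J < e.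
  move=> e0; exists (Num.truncn (4 / e)).
  rewrite ltr_pdivrMr // mulrC -ltr_pdivrMr //.
  exact: truncnS_gt.
(* If every [good t J] is inhabited, take a limit of points chosen in them;
   otherwise any point of the last inhabited one will do. *)
have centre t : exists x, forall J y, good t J y -> mdist x y <= 4 * r J.
  have [[J0 J0P]|allJ] := pselect (exists J, ~ exists y, good t J y).
    have exJ : exists J, `[< ~ exists y, good t J y >] by exists J0; apply/asboolP.
    case: (ex_minnP exJ) => -[|J] /asboolP noJ minJ.
      (* Here [good t 0] is already empty, so the bound is vacuous and the default [x0] serves. *)
      by exists x0 => J y yJ; case: noJ; exists y; exact: good_le yJ.
    have [x xJ] : exists x, good t J x.
      apply: contrapT => noJ'; have /minJ : `[< ~ exists y, good t J y >].
        exact/asboolP.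
      by rewrite ltnn.
    exists x => J' y yJ'; have [J'J|JJ'] := leqP J' J.
      by apply/ltW/(good_diam t) => //; exact: good_le xJ.
    by case: noJ; exists y; exact: good_le yJ'.
  have {}allJ J : exists y, good t J y.
    by apply: contrapT => noJ; apply: allJ; exists J.
  have [u uP] := choice allJ.
  have /cM[l ul] : cauchy (u @ \oo).
    apply/cauchy_seq_mdistP => e /r_small[J Je]; exists J => m n /ltnW Jm /ltnW Jn.
    apply: lt_trans Je; apply: (good_diam t).
      exact: good_le (uP m).
    exact: good_le (uP n).
  exists l => J y yJ; apply/ler_addgt0Pl => e e0.
  have [N uN] := (cvg_seq_mdistP u l).1 ul e e0.
  have luN := uN (maxn N J).+1 (leq_maxl _ _).
  have uyJ : mdist (u (maxn N J).+1) y < 4 * r J.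
    apply: (good_diam t) => //; apply: good_le (uP _).
    by rewrite ltnW // ltnS leq_maxr.
  by have := metric_triangle l (u (maxn N J).+1) y => ?; lra.
have [psi psiP] := choice centre.
exists psi => e /r_small[J Je].
(* Since [r] decreases, tolerance [r J] on all nets up to [J] makes [y] good up to [J]. *)
exists (flatten [seq net j | j <- iota 0 J.+1]), (r J); split => // t y ty.
apply: le_lt_trans Je; apply: psiP => j jJ z zj.
apply: (@lt_le_trans _ _ (r J)).
  apply: ty; apply/flatten_mapP; exists j => //.
  by rewrite mem_iota add0n ltnS.
by rewrite lef_pV2 ?posrE // ler_nat.
Qed.

(** * Pointwise access to simplicial filters and their morphisms *)

Definition level (X : sFilt) (n : nat) : filt :=
  @fobj (opposite Delta) Filt_cat X n.

Definition face (X : sFilt) {m n : nat} (s : monotone_map m n) :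
    level X n -> level X m :=
  filt_fun (@fmor (opposite Delta) Filt_cat X n m s).

Definition app {X Y : sFilt} (h : @mor sFilt X Y) (n : nat) :
    filt_hom (level X n) (level Y n) :=
  @component (opposite Delta) Filt_cat X Y h n.

Lemma app_face {X Y : sFilt} (h : @mor sFilt X Y) {m n : nat}
    (s : monotone_map m n) (b : level X n) :
  app h m (face X s b) = face Y s (app h n b).
Proof.
have := @naturality (opposite Delta) Filt_cat X Y h n m s.
by move=> /(congr1 (fun k : filt_hom (level X n) (level Y m) => k b)).
Qed.

Lemma smor_ext {X Y : sFilt} (h k : @mor sFilt X Y) :
  (forall n b, app h n b = app k n b) -> h = k.
Proof. by move=> hk; apply: nat_trans_ext => n; apply: filt_hom_ext; exact: hk. Qed.

Lemma smor_comp_app {X Y Z : sFilt} {h : @mor sFilt Y Z} {k : @mor sFilt X Y}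
    {l : @mor sFilt X Z} :
  mcomp h k = l -> forall n b, app h n (app k n b) = app l n b.
Proof. by move=> <-. Qed.

Lemma levelwise_natural {X Y : sFilt}
    {h : forall n, filt_hom (level X n) (level Y n)}
    (hs : forall m n (s : monotone_map m n) b,
      h m (face X s b) = face Y s (h n b))
    (n m : opposite Delta) (s : mor n m) :
  mcomp (h m : @mor Filt_cat _ _) (fmor X s) = mcomp (fmor Y s) (h n).
Proof. by apply: filt_hom_ext => b; exact: (hs m n s b). Qed.

Definition smor {X Y : sFilt} (h : forall n, filt_hom (level X n) (level Y n))
    (hs : forall m n (s : monotone_map m n) b,
      h m (face X s b) = face Y s (h n b)) : @mor sFilt X Y :=
  @NatTrans (opposite Delta) Filt_cat X Y h (levelwise_natural hs).

(** * Apexes and lifts to the shift *)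

Definition vertex {n : nat} (i : 'I_n.+1) : monotone_map 0 n :=
  @Monotone 0 n (fun=> i) (fun _ _ _ => leqnn i).

Definition coord {R : realType} {M : metricType R} {n : nat}
  (x : level (metric_sFilt M) n) : 'I_n.+1 -> M := x.

Definition apex {R : realType} {M : metricType R} {n : nat}
  (x : level (sshift (metric_sFilt M)) n) : M := @coord R M n.+1 x ord0.

Section Apex.
Context {R : realType} {M : metricType R} {B : sFilt}.

(** For continuous [g], this is what continuity of the tuple [g b] with [c n b] prepended amounts
    to. *)
Definition close_to (g : @mor sFilt B (metric_sFilt M))
    (c : forall n, level B n -> M) : Prop :=
  forall n (e : R), 0 < e ->
    @nbhd (level B n) [set b | forall i, mdist (c n b) (coord (app g n b) i) < e].

Definition face_invariant (c : forall n, level B n -> M) : Prop :=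
  forall m n (s : monotone_map m n) b, c m (face B s b) = c n b.

Lemma lift_coord {g : @mor sFilt B (metric_sFilt M)}
    {h : @mor sFilt B (sshift (metric_sFilt M))} :
  mcomp (shift_proj (metric_sFilt M)) h = g ->
  forall n b i, @coord R M n.+1 (app h n b) (lift ord0 i) = coord (app g n b) i.
Proof. by move=> <-. Qed.

(** [succ_map s] fixes the new minimal element, so taking a face keeps the apex. *)
Lemma apex_face_invariant (h : @mor sFilt B (sshift (metric_sFilt M))) :
  face_invariant (fun n b => apex (app h n b)).
Proof.
move=> m n s b; rewrite app_face /apex /coord /face /= /succ_fun.
by rewrite unlift_none.
Qed.

Lemma apex_close_to {g : @mor sFilt B (metric_sFilt M)}
    {h : @mor sFilt B (sshift (metric_sFilt M))} :
  mcomp (shift_proj (metric_sFilt M)) h = g ->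
  close_to g (fun n b => apex (app h n b)).
Proof.
move=> hg n e e0.
have nbe : @nbhd (level (metric_sFilt M) n.+1)
    [set x | forall i j, mdist (coord x i) (coord x j) < e] by exists e.
have := filt_cont (app h n) nbe.
apply: (@filterS _ _ (nbhd_filter (level B n))) => b /= be i.
by rewrite -(lift_coord hg); exact: be.
Qed.

(** Prepending [c] to [g] is natural by face invariance and continuous by closeness. *)
Lemma lift_of_apex (g : @mor sFilt B (metric_sFilt M))
    (c : forall n, level B n -> M) :
  face_invariant c -> close_to g c ->
  exists2 h : @mor sFilt B (sshift (metric_sFilt M)),
    mcomp (shift_proj (metric_sFilt M)) h = g &
    forall n b, apex (app h n b) = c n b.
Proof.
move=> cs cg.
pose h n (b : level B n) : level (sshift (metric_sFilt M)) n :=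
  fun i : 'I_n.+2 => if unlift ord0 i is Some j then coord (app g n b) j else c n b.
have h_cont n V : @nbhd (level (sshift (metric_sFilt M)) n) V ->
    @nbhd (level B n) (h n @^-1` V).
  move=> [e e0 eV].
  (* Two entries of [g b] are compared through the apex, hence the half. *)
  have e2 : 0 < e / 2 by rewrite divr_gt0.
  apply: (@filterS _ _ (nbhd_filter (level B n))) (cg n _ e2) => b /= be.
  apply: eV => i j; rewrite /h.
  have [? ?] : 0 < e /\ e / 2 < e by split; lra.
  case: unliftP => [i' _|_]; case: unliftP => [j' _|_].
  - have := be i'; have := be j'.
    have := metric_triangle (coord (app g n b) i') (c n b) (coord (app g n b) j').
    by rewrite (metric_sym _ (c n b)) => ? ? ?; lra.
  - by rewrite metric_sym; apply: lt_trans (be i') _.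
  - by apply: lt_trans (be j') _.
  - by rewrite mdistxx.
pose hh n := @FiltHom (level B n) (level (sshift (metric_sFilt M)) n) (h n)
  (h_cont n).
have hs m n (s : monotone_map m n) b :
    hh m (face B s b) = face (sshift (metric_sFilt M)) s (hh n b).
  apply/funext => i; rewrite /hh /= /h /face /= /succ_fun.
  case: unliftP => [j _|_]; last by rewrite unlift_none cs.
  by rewrite liftK app_face.
exists (smor hh hs) => [|n b]; last by rewrite /apex /coord /= /h unlift_none.
by apply: smor_ext => n b; apply/funext => i /=; rewrite /h liftK.
Qed.

End Apex.

(** * Functoriality in short maps *)

Section ShortMap.
Context {R : realType} {M N : metricType R} (phi : M -> N).
Hypothesis phi_short : forall x y, mdist (phi x) (phi y) <= mdist x y.

Lemma short_map_cont n V : @nbhd (level (metric_sFilt N) n) V ->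
  @nbhd (level (metric_sFilt M) n) ((fun x => phi \o coord x) @^-1` V).
Proof.
move=> [e e0 eV]; exists e => // x xe; apply: eV => i j.
exact: le_lt_trans (phi_short _ _) (xe i j).
Qed.

Definition short_map_level n :
    filt_hom (level (metric_sFilt M) n) (level (metric_sFilt N) n) :=
  @FiltHom (level (metric_sFilt M) n) (level (metric_sFilt N) n)
    (fun x => phi \o coord x) (short_map_cont n).

Definition short_map : @mor sFilt (metric_sFilt M) (metric_sFilt N) :=
  @smor (metric_sFilt M) (metric_sFilt N) short_map_level
    (fun m n s b => erefl).

(** Together with [short_map], this carries a lifting problem against [M] to one against [N]. *)
Definition short_map_shift :
    @mor sFilt (sshift (metric_sFilt M)) (sshift (metric_sFilt N)) :=
  @smor (sshift (metric_sFilt M)) (sshift (metric_sFilt N))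
    (fun n => short_map_level n.+1) (fun m n s b => erefl).

End ShortMap.

(** * Completeness and maps out of [Ncof_sFilt] *)

Lemma Ncof_coordE {R : realType} {M : metricType R}
    (g : @mor sFilt Ncof_sFilt (metric_sFilt M)) n (x : 'I_n.+1 -> nat) i :
  coord (app g n x) i = coord (app g 0 (fun=> x i)) ord0.
Proof.
(* Naturality along [vertex i]: the values on single numbers determine the map at every level. *)
by have /(congr1 (fun y => coord y ord0)) := app_face g (vertex i) x.
Qed.

Lemma lifts_Ncof_complete {R : realType} {M : metricType R} :
  lifts Ncof_arrow (metric_shift_arrow M) -> metric_complete M.
Proof.
move=> liftM u /cauchy_seq_mdistP uC.
pose g n : level Ncof_sFilt n -> level (metric_sFilt M) n :=
  fun x : 'I_n.+1 -> nat => u \o x.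
have g_cont n V : @nbhd (level (metric_sFilt M) n) V ->
    @nbhd (level Ncof_sFilt n) (g n @^-1` V).
  move=> [e e0 eV]; have [N uN] := uC e e0; exists N => x xN.
  by apply: eV => i j; exact: uN.
pose gm := @smor Ncof_sFilt (metric_sFilt M) (fun n => FiltHom (g_cont n))
  (fun m n s b => erefl).
have [h [_ hg]] := liftM (from_empty _) gm
  (etrans (from_empty_unique _) (esym (from_empty_unique _))).
have hs := apex_face_invariant h.
exists (apex (app h 0 (fun=> 0%N))); apply/cvg_seq_mdistP => e e0.
have [N NP] := apex_close_to hg 0 e e0; exists N => n Nn.
(* The apex does not depend on the vertex: (0, n) is an edge from 0 to n. *)
pose x : 'I_2 -> nat := fun i => if i == ord0 then 0%N else n.
have := hs _ _ (@vertex 1 ord_max) x; rewrite -(hs _ _ (@vertex 1 ord0) x) => h0n.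
have := NP (fun=> n) (fun=> Nn) ord0.
exact: etrans (congr1 (fun y => mdist y (u n) < e) (esym h0n)).
Qed.

Lemma complete_lifts_Ncof {R : realType} {M : metricType R} :
  metric_complete M -> lifts Ncof_arrow (metric_shift_arrow M).
Proof.
move=> cM f g _.
pose u k : M := coord (app g 0 (fun=> k)) ord0.
have [l ul] : exists l : M, u @ \oo --> l.
  apply: cM; apply/cauchy_seq_mdistP => e e0.
  (* The Cauchy property is continuity of [g] at level 1, tested on the edges [(m, n)]. *)
  have nbe : @nbhd (level (metric_sFilt M) 1)
      [set x | forall i j, mdist (coord x i) (coord x j) < e] by exists e.
  have [N NP] := filt_cont (app g 1) nbe; exists N => m n Nm Nn.
  pose x : 'I_2 -> nat := fun i => if i == ord0 then m else n.
  have /(_ ord0 ord_max) : forall i j,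
      mdist (coord (app g 1 x) i) (coord (app g 1 x) j) < e.
    by apply: NP => i; rewrite /x; case: ifP.
  by rewrite (Ncof_coordE g 1 x ord0) (Ncof_coordE g 1 x ord_max).
have [|h hg _] := @lift_of_apex _ _ Ncof_sFilt g (fun _ _ => l) (fun _ _ _ _ => erefl).
  move=> n e e0; have [N uN] := (cvg_seq_mdistP u l).1 ul e e0.
  by exists N => x xN i; rewrite /= Ncof_coordE; apply: (uN (x i)); exact: xN.
exists h; split=> //.
by rewrite (from_empty_unique f) (from_empty_unique (mcomp _ _)).
Qed.

(** * Precompact complete spaces *)

Lemma precompact_complete_right_orth {R : realType} {M : metricType R} :
  metric_precompact M -> metric_complete M ->
  right_orth (left_orth (@real_shift_arrow R)) (metric_shift_arrow M).
Proof.
move=> pM cM [A B i] /(_ _ erefl) liftR.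
change (forall (f : @mor sFilt A (sshift (metric_sFilt M)))
  (g : @mor sFilt B (metric_sFilt M)),
  mcomp (shift_proj (metric_sFilt M)) f = mcomp g i ->
  exists h : @mor sFilt B (sshift (metric_sFilt M)),
    mcomp h i = f /\ mcomp (shift_proj (metric_sFilt M)) h = g) => f g fg.
pose RR : metricType R := R^o.
pose phi z : M -> RR := mdist z.
have phi_short z x y : mdist (phi z x) (phi z y) <= mdist x y.
  by rewrite {1}/mdist /= distrC; exact: ler_dist_mdist.
have hR z : exists hz : @mor sFilt B (sshift (metric_sFilt RR)),
    mcomp hz i = mcomp (short_map_shift (phi z) (phi_short z)) f /\
    mcomp (shift_proj (metric_sFilt RR)) hz =
      mcomp (short_map (phi z) (phi_short z)) g.
  apply: liftR; apply: (@smor_ext A (metric_sFilt RR)) => n a.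
  exact: (congr1 (fun x => phi z \o coord x) (smor_comp_app fg n a)).
have [k kP] := choice hR.
(* An inhabited level of [B] supplies, through [g], the point of [M] that the retraction lemma asks
   for. If all levels are empty, every condition on a lift is vacuous. *)
have [[n0 [b0 _]]|noB] := pselect (exists n (b : level B n), True); last first.
  have [||h hg _] := @lift_of_apex _ M B g (fun n b => coord (app g n b) ord0).
  - by move=> m n s b; case: noB; exists n, b.
  - move=> n e e0; apply: (@filterS _ _ (nbhd_filter (level B n)) setT).
      by move=> b _; case: noB; exists n, b.
    exact: (@filterT _ _ (nbhd_filter (level B n))).
  exists h; split=> //; apply: smor_ext => n a.
  by case: noB; exists n, (app i n a).
have [psi psiP] := kuratowski_retraction pM cM (coord (app g n0 b0) ord0).
have psiK x : psi (mdist ^~ x) = x.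
  apply: mdist_positivity; apply/eqP; rewrite eq_le mdist_ge0 andbT.
  apply/ler_addgt0Pr => e /psiP[s [d [d0 psi_lt]]]; rewrite add0r.
  by apply/ltW/psi_lt => z _; rewrite subrr normr0.
pose c n (b : level B n) : M := psi (fun z => apex (app (k z) n b)).
have [||h hg hc] := @lift_of_apex _ M B g c.
- move=> m n s b; congr psi; apply/funext => z.
  exact: (apex_face_invariant (k z)).
- move=> n e /psiP[s [d [d0 psi_lt]]].
  have nb := nbhd_filter (level B n).
  suff : @nbhd (level B n) [set b | forall z, z \in s -> forall j,
      `|apex (app (k z) n b) - mdist z (coord (app g n b) j)| < d].
    by apply: filterS => b /= bs j; apply: psi_lt => z /bs.
  (* Only finitely many [z] are tested, so finitely many neighbourhoods are intersected. *)
  elim: s {psi_lt} => [|z s IHs]; first by apply: filterS filterT.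
  apply: filterS (filterI IHs (apex_close_to (kP z).2 n d d0)) => b [/= bs bz].
  move=> y; rewrite inE => /orP[/eqP-> j|]; last exact: bs.
  by rewrite distrC; exact: bz.
exists h; split=> //; apply: smor_ext => n a.
apply/funext => j; case: (@unliftP n.+2 ord0 j) => [j' ->|->].
  exact: (etrans (lift_coord hg n (app i n a) j')
    (esym (lift_coord fg n a j'))).
(* On the image of [i], the apex of [k z] is the distance from [z] to the apex of [f], which [psi]
   recovers by [psiK]. *)
have := hc n (app i n a); rewrite /apex /coord /= => ->.
rewrite /c -[RHS]psiK; congr psi; apply/funext => z.
exact: (congr1 apex (smor_comp_app (kP z).1 n a)).
Qed.

Theorem mainTheorem6 (R : realType) (M : metricType R) :
  [/\ (* (a) *)
      [/\ metric_complete M <-> lifts Ncof_arrow (metric_shift_arrow M),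
          left_orth (@complete_shift_arrows R) Ncof_arrow
        & left_orth (@real_shift_arrow R) Ncof_arrow],
      (* (b) *)
      right_orth (left_orth (@real_shift_arrow R)) (metric_shift_arrow M) ->
        metric_complete M
    & (* (c) *)
      metric_precompact M -> metric_complete M ->
        right_orth (left_orth (@real_shift_arrow R)) (metric_shift_arrow M)].
Proof.
have NcofR : left_orth (@real_shift_arrow R) Ncof_arrow.
  by move=> _ ->; apply: complete_lifts_Ncof; exact: real_metric_complete.
split; last exact: precompact_complete_right_orth.
  split=> //; first by split; [exact: complete_lifts_Ncof|exact: lifts_Ncof_complete].
  by move=> _ [N [cN ->]]; exact: complete_lifts_Ncof.
by move=> /(_ _ NcofR); exact: lifts_Ncof_complete.
Qed.
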